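(* Let $(D,\varphi)$ be an étale $\varphi$-module over $K$ that has a generator $x$, and let $\chi_{\varphi,x}$ be its semi-characteristic polynomial with respect to $x$ in some basis. Then the map that sends a quotient $D\to D_2$ of the $\varphi$-module $D$ (with induced map $\varphi_2$ on $D_2$, and $\bar x$ the image of $x$ in $D_2$) to the semi-characteristic polynomial $\chi_{\varphi_2,\bar x}$ is a bijection from the set of quotients of the $\varphi$-module $D$ onto the set of monic right-divisors of $\chi_{\varphi,x}$ in $K[X,\sigma]$. Moreover, under this bijection the irreducible divisors correspond exactly to the simple quotients.
   Context: $K$ is a field of characteristic $p>0$, $q=p^a$ with $a\ge1$, $\mathbb{F}_q\subset K$, $\sigma(y)=y^q$. $K[X,\sigma]$ is the skew polynomial ring with $X\cdot c=\sigma(c)\cdot X$ for $c\in K$; $A$ is a right-divisor of $B$ if $B=UA$ for some $U\in K[X,\sigma]$. A $\varphi$-module over $K$ is a finite-dimensional $K$-vector space $D$ with an additive map $\varphi:D\to D$ such that $\varphi(\lambda y)=\sigma(\lambda)\varphi(y)$; it is étale if the image of $\varphi$ contains a basis of $D$; it is simple if it has no nontrivial $\varphi$-stable subspace. Quotients of $D$ are the $\varphi$-modules $D/D'$ for $D'$ a $\varphi$-stable subspace (two quotients being equal when their kernels are equal). An element $x$ is a generator of a $\varphi$-module $D$ of dimension $d$ if $(x,\varphi(x),\dots,\varphi^{d-1}(x))$ is a basis of $D$. When $x$ is a generator, the semi-characteristic polynomial $\chi_{\varphi,x}$ is the unique monic skew polynomial $X^d-\sum_{i<d}p_iX^i$ of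 degree $d=\dim D$ such that $\varphi^d(x)=\sum_{i<d}p_i\varphi^i(x)$ (for the zero module it is $1$). The image of a generator in a quotient is a generator of that quotient. *)

(* Defs.v *)
From HB Require Import structures.
From mathcomp Require Import all_boot all_order all_algebra.
From mathcomp Require Import ring_quotient generic_quotient.

Set Implicit Arguments.
Unset Strict Implicit.
Unset Printing Implicit Defensive.

Import GRing.Theory VectorInternalTheory.
Local Open Scope ring_scope.
Local Open Scope quotient_scope.

Definition frobq (K : fieldType) (p : nat) (charK : p \in [pchar K]) (a : nat)
  (y : K) : K := y ^+ (p ^ a).

Section FrobqMorphism.
Variables (K : fieldType) (p : nat) (charK : p \in [pchar K]) (a : nat).

Fact frobq_is_zmod_morphism : zmod_morphism (frobq charK a).
Proof.
have pa : [pchar K].-nat (p ^ a)%N.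
  rewrite pnatX; apply/orP; left; rewrite pnatE //.
  exact: (pcharf_prime charK).
by move=> x y; rewrite /frobq exprDn_pchar // exprNn_pchar.
Qed.

Fact frobq_is_monoid_morphism : monoid_morphism (frobq charK a).
Proof. by split=> [|x y]; rewrite /frobq ?expr1n ?exprMn. Qed.

HB.instance Definition _ :=
  GRing.isZmodMorphism.Build K K (frobq charK a) frobq_is_zmod_morphism.
HB.instance Definition _ :=
  GRing.isMonoidMorphism.Build K K (frobq charK a) frobq_is_monoid_morphism.
End FrobqMorphism.

(* A skew polynomial is stored as the list of its left coefficients: the      *)
(* underlying additive group is that of {poly K}, only the product is         *)
(* twisted.  The product of {poly K} itself must not be used on skew_poly.    *)
Definition skew_poly (K : fieldType) (sigma : {rmorphism K -> K}) := {poly K}.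

Section SkewPolyRing.
Variables (K : fieldType) (sigma : {rmorphism K -> K}).
Local Notation S := (skew_poly sigma).
Implicit Types A B C : S.

HB.instance Definition _ := GRing.Zmodule.copy S {poly K}.

(* Bilinear extension of a X^j * b X^k = a sigma^j(b) X^(j + k). *)
Definition skew_mul A B : S :=
  \poly_(i < (size A + size B).-1)
    \sum_(j < i.+1) A`_j * iter j sigma B`_(i - j).

Let iter0 n : iter n sigma 0 = 0.
Proof. by elim: n => //= n ->; rewrite rmorph0. Qed.
Let iter1 n : iter n sigma 1 = 1.
Proof. by elim: n => //= n ->; rewrite rmorph1. Qed.
Let sigmaD n : {morph iter n sigma : x y / x + y}.
Proof. by elim: n => //= n IH x y; rewrite !iterS IH rmorphD. Qed.
Let sigmaM n : {morph iter n sigma : x y / x * y}.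
Proof. by elim: n => //= n IH x y; rewrite !iterS IH rmorphM. Qed.

Lemma coef_skew_mul A B i :
  (skew_mul A B)`_i = \sum_(j < i.+1) A`_j * iter j sigma B`_(i - j).
Proof.
rewrite coef_poly ltn_predRL; case: leqP => // le_AB_i1.
rewrite big1 // => j _; have [lA|lt_jA] := leqP (size A) j.
  by rewrite nth_default ?mul0r.
rewrite [B`__]nth_default ?iter0 ?mulr0 // leq_subRL -ltnS //.
by rewrite (leq_trans _ le_AB_i1) // ltn_add2r.
Qed.

Let coef_skew_mul_rev A B i :
  (skew_mul A B)`_i = \sum_(j < i.+1) A`_(i - j) * iter (i - j) sigma B`_j.
Proof.
rewrite coef_skew_mul (reindex_inj rev_ord_inj) /=.
by apply: eq_bigr => j _; rewrite subSS (sub_ordK j).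
Qed.

Fact skew_mulA : associative skew_mul.
Proof.
move=> A B C; apply/polyP=> i; rewrite coef_skew_mul coef_skew_mul_rev.
pose coef3 (j k : nat) :=
  A`_j * (iter j sigma B`_(i - j - k) * iter (i - k) sigma C`_k).
transitivity (\sum_(j < i.+1) \sum_(k < i.+1 | (k <= i - j)%N) coef3 j k).
  apply: eq_bigr => /= j _; rewrite coef_skew_mul_rev.
  rewrite (big_morph _ (sigmaD j) (iter0 j)) big_distrr /=.
  rewrite (big_ord_narrow_leq (leq_subr _ _)); apply: eq_bigr => k _ /=.
  have le_ji : (j <= i)%N by rewrite -ltnS.
  rewrite /coef3 sigmaM -iterD; congr (_ * (_ * iter _ _ _)).
  by rewrite addnBA ?subnKC // -ltnS.
rewrite (exchange_big_dep predT) //=; apply: eq_bigr => k _.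
transitivity (\sum_(j < i.+1 | (j <= i - k)%N) coef3 j k).
  apply: eq_bigl => j; rewrite -ltnS -(ltnS j) -!subSn ?leq_ord //.
  by rewrite -subn_gt0 -(subn_gt0 j) -!subnDA addnC.
rewrite (big_ord_narrow_leq (leq_subr _ _)) coef_skew_mul big_distrl /=.
by apply: eq_bigr => j _; rewrite /coef3 -!subnDA addnC mulrA.
Qed.

Fact skew_mul1l : left_id (1%:P : S) skew_mul.
Proof.
move=> A; apply/polyP => i; rewrite coef_skew_mul big_ord_recl subn0.
by rewrite big1 => [|j _]; rewrite coefC /= ?mul1r ?addr0 ?mul0r.
Qed.

Fact skew_mul1r : right_id (1%:P : S) skew_mul.
Proof.
move=> A; apply/polyP => i; rewrite coef_skew_mul_rev big_ord_recl subn0.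
rewrite big1 => [|j _]; rewrite coefC /= ?iter1 ?mulr1 ?addr0 //.
by rewrite iter0 mulr0.
Qed.

Fact skew_mulDl : left_distributive skew_mul +%R.
Proof.
move=> A B C; apply/polyP=> i; rewrite coefD !coef_skew_mul -big_split.
by apply: eq_bigr => j _; rewrite coefD mulrDl.
Qed.

Fact skew_mulDr : right_distributive skew_mul +%R.
Proof.
move=> A B C; apply/polyP=> i; rewrite coefD !coef_skew_mul -big_split.
by apply: eq_bigr => j _; rewrite coefD sigmaD mulrDr.
Qed.

Fact skew_poly1_neq0 : (1%:P : S) != 0.
Proof. exact: oner_neq0. Qed.

HB.instance Definition _ := GRing.Zmodule_isNzRing.Build S
  skew_mulA skew_mul1l skew_mul1r skew_mulDl skew_mulDr skew_poly1_neq0.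

Definition skewC (c : K) : S := c%:P.
Definition skewX : S := 'X.

Lemma skew_mulXC (c : K) : skewX * skewC c = skewC (sigma c) * skewX.
Proof.
apply/polyP => i; rewrite !coef_skew_mul.
case: i => [|i]; first by rewrite !big_ord1 !coefX !coefC /= mulr0 mul0r.
rewrite [RHS]big_ord_recl [X in _ + X]big1 ?addr0 => [|j _]; last first.
  by rewrite coefC mul0r.
rewrite [LHS]big_ord_recl coefX mul0r add0r [LHS]big_ord_recl.
rewrite [X in _ + X]big1 ?addr0 => [|j _]; last by rewrite coefX mul0r.
rewrite !coefX !coefC /bump /= subn0 subSS subn0 mul1r.
by case: i => [|i]; rewrite ?mulr1 ?mulr0 ?rmorph0.
Qed.

End SkewPolyRing.

Definition right_divides (R : nzRingType) (A B : R) : Prop :=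
  exists U : R, B = U * A.

Definition two_sided_unit (R : nzRingType) (u : R) : Prop :=
  exists v : R, u * v = 1 /\ v * u = 1.

Definition irreducible_elt (R : nzRingType) (A : R) : Prop :=
  [/\ A != 0, ~ two_sided_unit A
    & forall B C : R, A = B * C -> two_sided_unit B \/ two_sided_unit C].

(* The vector space D / U, as a genuine type of cosets. *)
Definition quotv (K : fieldType) (D : vectType K) (U : {vspace D}) : Type :=
  Quotient.quot (pred_of_vspace U).

Section QuotientSpace.
Variables (K : fieldType) (D : vectType K) (U : {vspace D}).
Local Notation Q := (quotv U).

HB.instance Definition _ := GRing.Zmodule.on Q.
HB.instance Definition _ := EqQuotient.on Q.

Definition quotv_proj (y : D) : Q := \pi_Q y.

Lemma eq_quotv_proj y z : (quotv_proj y == quotv_proj z) = (y - z \in U).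
Proof. by rewrite [RHS](@Quotient.idealrBE D (pred_of_vspace U)). Qed.

Lemma quotv_projK : cancel (repr : Q -> D) quotv_proj.
Proof. exact: reprK. Qed.

Lemma quotv_projB : zmod_morphism quotv_proj.
Proof. by move=> y z; rewrite /quotv_proj raddfB. Qed.

Definition quotv_scale (c : K) (v : Q) : Q := quotv_proj (c *: repr v).

Lemma quotv_projZ c y : quotv_proj (c *: y) = quotv_scale c (quotv_proj y).
Proof.
apply/eqP; rewrite eq_quotv_proj -scalerBr memvZ //.
by rewrite -eq_quotv_proj quotv_projK.
Qed.

Let quotv_projD y z : quotv_proj (y + z) = quotv_proj y + quotv_proj z.
Proof. by rewrite /quotv_proj raddfD. Qed.

Fact quotv_scalerA c d v :
  quotv_scale c (quotv_scale d v) = quotv_scale (c * d) v.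
Proof. by rewrite -[v]quotv_projK -!quotv_projZ scalerA. Qed.
Fact quotv_scale1r : left_id 1 quotv_scale.
Proof. by move=> v; rewrite -[v]quotv_projK -!quotv_projZ scale1r. Qed.
Fact quotv_scalerDr : right_distributive quotv_scale +%R.
Proof.
move=> c v w; rewrite -[v]quotv_projK -[w]quotv_projK.
by rewrite -quotv_projD -!quotv_projZ scalerDr quotv_projD.
Qed.
Fact quotv_scalerDl v : {morph quotv_scale^~ v : c d / c + d}.
Proof.
by move=> c d; rewrite -[v]quotv_projK -!quotv_projZ scalerDl quotv_projD.
Qed.

HB.instance Definition _ := GRing.Zmodule_isLmodule.Build K Q
  quotv_scalerA quotv_scale1r quotv_scalerDr quotv_scalerDl.

Fact quotv_proj_linear : linear quotv_proj.
Proof. by move=> c y z; rewrite quotv_projD quotv_projZ. Qed.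
HB.instance Definition _ :=
  GRing.isLinear.Build K D Q _ quotv_proj quotv_proj_linear.

(* D / U is identified with the complement U^C to get its coordinates. *)
Let compl_of (y : D) : subvs_of (U^C)%VS := vsproj _ (daddv_pi (U^C)%VS U y).

Let UC0 : (U :&: U^C = 0)%VS. Proof. exact: capv_compl. Qed.
Let CU0 : (U^C :&: U = 0)%VS. Proof. by rewrite capvC capv_compl. Qed.

Let compl_ofE y : y - val (compl_of y) \in U.
Proof.
rewrite /compl_of /= vsprojK ?memv_pi //.
have yUC : y \in (U^C + U)%VS by rewrite addvC addv_complf memvf.
rewrite -{1}(daddv_pi_add CU0 yUC) addrAC subrr add0r; exact: memv_pi.
Qed.

Let compl_of0 y : y \in U -> compl_of y = 0.
Proof.
move=> Uy; apply: val_inj; apply/eqP; rewrite -memv0 -UC0 memv_cap subvsP andbT.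
by rewrite -[val _](subKr y) memvB ?compl_ofE.
Qed.

Let coords (v : Q) := v2r (compl_of (repr v)).

Let coords_proj y : coords (quotv_proj y) = v2r (compl_of y).
Proof.
congr v2r; apply/eqP; rewrite -subr_eq0 /compl_of -!linearB /=.
by apply/eqP; apply: compl_of0; rewrite -eq_quotv_proj quotv_projK.
Qed.

Fact quotv_vect_iso : Vector.axiom (dim (subvs_of (U^C)%VS)) Q.
Proof.
exists coords.
  move=> c v w; rewrite -[v]quotv_projK -[w]quotv_projK -linearP.
  by rewrite !coords_proj /compl_of !linearP.
exists (fun r => quotv_proj (val (r2v r : subvs_of (U^C)%VS))) => [v|r].
  rewrite -[v]quotv_projK coords_proj v2rK; apply/eqP.
  by rewrite eq_quotv_proj -memvN opprB compl_ofE.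
rewrite coords_proj -[RHS]r2vK; congr v2r; apply: val_inj; apply/eqP.
rewrite -subr_eq0 -memv0 -UC0 memv_cap; apply/andP; split.
  by rewrite -memvN opprB compl_ofE.
exact: memvB (subvsP _) (subvsP _).
Qed.

HB.instance Definition _ := Lmodule_hasFinDim.Build K Q quotv_vect_iso.

End QuotientSpace.

(* A phi-module over (K, sigma) is a vectType D over K together with a        *)
(* phi : {linear D -> D | sigma \; *:%R}, i.e. an additive map such that      *)
(* phi (c *: y) = sigma c *: phi y.                                           *)
Section PhiModule.
Variables (K : fieldType) (sigma : {rmorphism K -> K}) (D : vectType K).
Variable phi : {linear D -> D | sigma \; *:%R}.

Definition etale : Prop :=
  exists2 b : seq D, basis_of fullv b & {in b, forall y, exists z, y = phi z}.

Definition phi_stable (U : {vspace D}) : Prop := {homo phi : y / y \in U}.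

(* The zero module is not simple, in accordance with 1 not being irreducible. *)
Definition simple_phi : Prop :=
  (exists y : D, y != 0) /\
  forall U : {vspace D}, phi_stable U -> U = 0%VS \/ U = fullv.

Definition phi_orbit (x : D) : (\dim {:D}).-tuple D :=
  [tuple iter i phi x | i < \dim {:D}].

Definition generator (x : D) : Prop := basis_of fullv (phi_orbit x).

Definition semichar_coef (x : D) (i : 'I_(\dim {:D})) : K :=
  coord (phi_orbit x) i (iter (\dim {:D}) phi x).

(* Meaningful when x is a generator; for D = 0 the sum is empty and the       *)
(* value is 1.                                                                *)
Definition semichar (x : D) : skew_poly sigma :=
  skewX sigma ^+ (\dim {:D}) -
    \sum_(i < \dim {:D}) skewC sigma (semichar_coef x i) * skewX sigma ^+ i.

Lemma semichar_coefE x : generator x ->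
  iter (\dim {:D}) phi x =
    \sum_(i < \dim {:D}) semichar_coef x i *: iter i phi x.
Proof.
move=> gx; rewrite [LHS](coord_basis gx (memvf _)).
by apply: eq_bigr => i _; rewrite -tnth_nth tnth_mktuple.
Qed.

Lemma semichar_coef_uniq x (c : 'I_(\dim {:D}) -> K) : generator x ->
  iter (\dim {:D}) phi x = \sum_(i < \dim {:D}) c i *: iter i phi x ->
  c =1 semichar_coef x.
Proof.
move=> gx xE i; rewrite /semichar_coef xE.
under eq_bigr => j _ do
  rewrite -[iter j phi x](tnth_mktuple (fun k : 'I_ _ => iter k phi x))
    (tnth_nth 0).
by rewrite coord_sum_free ?(basis_free gx).
Qed.

Record phi_subspace := PhiSubspace {
  phi_subspace_val :> {vspace D};
  phi_subspaceP : phi_stable phi_subspace_val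
}.

End PhiModule.

Section PhiQuotient.
Variables (K : fieldType) (sigma : {rmorphism K -> K}) (D : vectType K).
Variables (phi : {linear D -> D | sigma \; *:%R}) (U : phi_subspace phi).

Definition quot_phi (v : quotv U) : quotv U := quotv_proj U (phi (repr v)).

Lemma quot_phiE y : quot_phi (quotv_proj U y) = quotv_proj U (phi y).
Proof.
apply/eqP; rewrite eq_quotv_proj -linearB; apply: phi_subspaceP.
by rewrite -eq_quotv_proj quotv_projK.
Qed.

Fact quot_phi_semilinear : linear_for (sigma \; *:%R) quot_phi.
Proof.
move=> c v w; rewrite -[v]quotv_projK -[w]quotv_projK -linearP !quot_phiE.
by rewrite linearP linearP.
Qed.

HB.instance Definition _ := GRing.isLinear.Build K (quotv U) (quotv U)
  (sigma \; *:%R) quot_phi quot_phi_semilinear.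

End PhiQuotient.
Arguments quot_phi {K sigma D phi} U v.

(* Main.v *)
(* The skew polynomial ring acts on D through P . y = sum_i P_i phi^i(y), which
   turns D into the cyclic left module generated by x, whose annihilator of x
   is the left ideal generated by chi (by Euclidean right division).  For a
   stable subspace U, the quotient D / U is generated by the image of x, so
   P . x lies in U exactly when chi_U right-divides P; this determines U from
   chi_U.  Conversely a monic right divisor A of chi is recovered from the
   submodule generated by A . x. *)
Require Import Defs.
From HB Require Import structures.
From mathcomp Require Import all_boot all_order all_algebra.
From mathcomp Require Import zify.

Set Implicit Arguments.
Unset Strict Implicit.
Unset Printing Implicit Defensive.

Import GRing.Theory.
Local Open Scope ring_scope.

(** * Degrees, cancellation and right division in the skew polynomial ring *)

Section SkewPolyTheory.
Variables (K : fieldType) (sigma : {rmorphism K -> K}).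
Local Notation S := (skew_poly sigma).
Implicit Types A B C P Q : S.

Lemma iter_rmorph0 n : iter n sigma 0 = 0.
Proof. by elim: n => //= n ->; rewrite rmorph0. Qed.

Lemma iter_rmorph1 n : iter n sigma 1 = 1.
Proof. by elim: n => //= n ->; rewrite rmorph1. Qed.

Lemma iter_rmorph_eq0 n c : (iter n sigma c == 0) = (c == 0).
Proof. by elim: n => //= n IH; rewrite fmorph_eq0. Qed.

Lemma skew_mulCl c A : skewC sigma c * A = c *: (A : {poly K}).
Proof.
apply/polyP=> i; rewrite coef_skew_mul coefZ big_ord_recl coefC subn0 /=.
by rewrite big1 ?addr0 // => j _; rewrite coefC mul0r.
Qed.

(** Right multiplication by X involves no twist, since iterates of [sigma] fix 0 and 1. Powers of X
    and induction on coefficients therefore carry over from [{poly K}]. *)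
Lemma skew_mulXr A : A * skewX sigma = (A : {poly K}) * 'X.
Proof.
apply/polyP=> i; rewrite coef_skew_mul coefMX.
case: i => [|i]; first by rewrite big_ord1 coefX iter_rmorph0 mulr0.
rewrite big_ord_recr big_ord_recr /= big1 => [|j _]; last first.
  have neq: (i.+1 - j == 1)%N = false.
    by rewrite subSn 1?ltnW // eqSS subn_eq0 leqNgt ltn_ord.
  by rewrite coefX neq mulr0n iter_rmorph0 mulr0.
rewrite add0r !coefX subSnn subnn mulr0n [iter i _ _]iter_rmorph1 mulr1.
by rewrite iter_rmorph0 rmorph0 mulr0 addr0.
Qed.

Lemma coef_skew_mulXl A i :
  (skewX sigma * A)`_i = if i is j.+1 then sigma A`_j else 0.
Proof.
rewrite coef_skew_mul big_ord_recl coefX mul0r add0r.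
case: i => [|i]; first by rewrite big_ord0.
rewrite big_ord_recl big1 ?addr0 => [|j _]; last by rewrite coefX mul0r.
by rewrite coefX /bump /= mul1r subSS subn0.
Qed.

Lemma skewXnE n : skewX sigma ^+ n = 'X^n :> {poly K}.
Proof. by elim: n => // n IH; rewrite exprSr skew_mulXr IH -exprSr. Qed.

Lemma skew_poly_ind (T : S -> Prop) :
  T 0 -> (forall A c, T A -> T (A * skewX sigma + skewC sigma c)) ->
  forall A, T A.
Proof.
move=> T0 TS; apply: poly_ind => // A c TA.
by rewrite -[(_ * _)%R](skew_mulXr A); apply: TS.
Qed.

(** At the top index only j = deg A survives: below it the factor from B vanishes, above it the one
    from A. *)
Lemma lead_skew_mul A B : A != 0 -> B != 0 ->
  (A * B)`_((size A).-1 + (size B).-1)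
    = lead_coef A * iter (size A).-1 sigma (lead_coef B).
Proof.
move=> A0 B0; rewrite coef_skew_mul.
have ltA : ((size A).-1 < ((size A).-1 + (size B).-1).+1)%N.
  by rewrite ltnS leq_addr.
rewrite (bigD1 (Ordinal ltA)) //= addKn big1 ?addr0 // => j neq_j.
have [lt_jA|lt_Aj|eq_j] := ltngtP j (size A).-1; last first.
- by case/eqP: neq_j; apply: val_inj.
- by rewrite nth_default ?mul0r // (leq_trans (leqSpred _)).

rewrite [B`__]nth_default ?iter_rmorph0 ?mulr0 //.
have arith a b k : (0 < b -> k < a.-1 -> b <= a.-1 + b.-1 - k)%N by lia.
by apply: arith lt_jA; rewrite size_poly_gt0.
Qed.

(** The coefficient in degree deg A + deg B is nonzero, because [sigma] is injective on the field
    K. *)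
Lemma skew_mul_neq0 A B : A != 0 -> B != 0 -> A * B != 0.
Proof.
move=> A0 B0; apply: contraTneq isT => AB0.
have /esym/eqP := lead_skew_mul A0 B0.
rewrite AB0 coef0 mulf_eq0 iter_rmorph_eq0 !lead_coef_eq0.
by rewrite (negPf A0) (negPf B0).
Qed.

Lemma skew_mulIr A : A != 0 -> injective (fun B => B * A).
Proof.
move=> A0 B C /eqP; rewrite -subr_eq0 -mulrBl => BCA.
apply/eqP; rewrite -subr_eq0; apply: contraLR BCA => BC0.
exact: skew_mul_neq0.
Qed.

(** Cancel A on the right in (A B) A = A (B A) = A. *)
Lemma skew_unit_of_left_inverse A B : B * A = 1 -> two_sided_unit A.
Proof.
move=> BA1; exists B; split=> //.
have A0 : A != 0.
  by apply: contraTneq isT => A0; have := oner_neq0 S; rewrite -BA1 A0 mulr0 eqxx.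
by apply: (skew_mulIr A0); rewrite /= -mulrA BA1 mulr1 mul1r.
Qed.

Lemma leq_size_skew_mul A B : A != 0 -> B != 0 -> (size B <= size (A * B)%R)%N.
Proof.
move=> A0 B0; rewrite leqNgt; apply/negP => lt_AB.
have /esym/eqP := lead_skew_mul A0 B0.
rewrite nth_default ?mulf_eq0 ?iter_rmorph_eq0 ?lead_coef_eq0.
  by rewrite (negPf A0) (negPf B0).
have arith a b c : (c < b -> c <= a.-1 + b.-1)%N by lia.
exact: arith lt_AB.
Qed.

(** Mutual divisibility equates the degrees, so the leading terms cancel in B - A = (U - 1) A. A
    nonzero left multiple of A cannot have degree below deg A, hence U = 1. *)
Lemma right_divides_monic_eq A B : A \is monic -> B \is monic ->
  right_divides A B -> right_divides B A -> A = B.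
Proof.
move=> monA monB [U BUA] [V AVB].
have [A0 B0] : (A != 0) /\ (B != 0) by split; apply: monic_neq0.
have U0 : U != 0 by apply: contraNneq B0 => U0; rewrite BUA U0 mul0r.
have V0 : V != 0 by apply: contraNneq A0 => V0; rewrite AVB V0 mul0r.
have eqs : size A = size B.
  apply: anti_leq; apply/andP; split.
    by rewrite BUA leq_size_skew_mul.
  by rewrite AVB leq_size_skew_mul.
have BE : B - A = (U - 1) * A by rewrite mulrBl mul1r -BUA.
apply/eqP; rewrite eq_sym -subr_eq0; apply: contraTT isT => BA0.
have U1 : U - 1 != 0 by apply: contraNneq BA0 => U1; rewrite BE U1 mul0r.
have := leq_size_skew_mul U1 A0; rewrite -BE leqNgt => /negP[].
have sA : (0 < size A)%N by rewrite size_poly_gt0.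
rewrite -(prednK sA) ltnS; apply/leq_sizeP => i le_i.
rewrite coefB; have [->|neq_i] := eqVneq i (size A).-1.
  by rewrite {1}eqs -!lead_coefE (monicP monA) (monicP monB) subrr.
have le_Ai : (size A <= i)%N.
  have arith a k : (0 < a -> a.-1 <= k -> k != a.-1 -> a <= k)%N by lia.
  exact: arith sA le_i neq_i.
by rewrite !nth_default ?subrr // -eqs.
Qed.

Lemma skew_right_division A P : A \is monic ->
  exists Q R : S, P = Q * A + R /\ (size R < size A)%N.
Proof.
move=> monA; have A0 : A != 0 by apply: monic_neq0.
have sA : (0 < size A)%N by rewrite size_poly_gt0.
have [n] := ubnP (size P); elim: n P => // n IH P; rewrite ltnS => le_Pn.
have [ltPA|leAP] := ltnP (size P) (size A).
  by exists 0, P; rewrite mul0r add0r.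
have P0 : P != 0 by rewrite -size_poly_gt0 (leq_trans sA).
have lP : lead_coef P != 0 by rewrite lead_coef_eq0.
(* Since A is monic and [sigma] fixes 1, M * A has the same leading term as P, so P - M * A has
   smaller size. *)
pose M : S := lead_coef P *: 'X^(size P - size A).
have sM : size M = (size P - size A).+1 by rewrite size_scale // size_polyXn.
have M0 : M != 0 by rewrite -size_poly_gt0 sM.
have lM : lead_coef M = lead_coef P by rewrite lead_coefZ lead_coefXn mulr1.
have : (size (P - M * A)%R < n)%N.
  apply: leq_trans le_Pn; have sP := leq_trans sA leAP.
  rewrite -(prednK sP) ltnS; apply/leq_sizeP => i le_i.
  rewrite coefB; have [->|neq_i] := eqVneq i (size P).-1.
    rewrite -lead_coefE.
    have -> : (size P).-1 = ((size M).-1 + (size A).-1)%N.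
      have arith a b : (0 < a -> a <= b -> b.-1 = (b - a).+1.-1 + a.-1)%N by lia.
      by rewrite sM; apply: arith.
    by rewrite lead_skew_mul // (monicP monA) iter_rmorph1 mulr1 lM subrr.
  have le_Pi : (size P <= i)%N.
    have arith a k : (0 < a -> a.-1 <= k -> k != a.-1 -> a <= k)%N by lia.
    exact: arith sP le_i neq_i.
  rewrite !nth_default ?subrr //; apply: leq_trans le_Pi.
  apply: leq_trans (size_poly _ _) _.
  have arith a b : (0 < a -> a <= b -> ((b - a).+1 + a).-1 <= b)%N by lia.
  by rewrite sM; apply: arith.
case/IH=> Q [R [PE sR]]; exists (M + Q), R; split=> //.
by rewrite mulrDl -addrA -PE addrC subrK.
Qed.

End SkewPolyTheory.

(** * The module structure of D over the skew polynomial ring *)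

Section SkewAction.
Variables (K : fieldType) (sigma : {rmorphism K -> K}) (D : vectType K).
Variable phi : {linear D -> D | sigma \; *:%R}.
Local Notation S := (skew_poly sigma).
Implicit Types (P Q : S) (x y z : D).

Definition skew_act P y : D := \sum_(i < size P) P`_i *: iter i phi y.

(** Padding with zero coefficients lets polynomials of different sizes be evaluated over a common
    range. *)
Lemma skew_actE n P y : (size P <= n)%N ->
  skew_act P y = \sum_(i < n) P`_i *: iter i phi y.
Proof.
move=> le_Pn; rewrite /skew_act.
rewrite (big_ord_widen _ (fun i => P`_i *: iter i phi y) le_Pn).
rewrite big_mkcond; apply: eq_bigr => i _; case: ltnP => // le_Pi.
by rewrite nth_default ?scale0r.
Qed.

Lemma skew_actD P Q y : skew_act (P + Q) y = skew_act P y + skew_act Q y.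
Proof.
rewrite (skew_actE y (leq_maxl (size P) (size Q))).
rewrite (skew_actE y (leq_maxr (size P) (size Q))).
rewrite (skew_actE y (size_polyD P Q)) -big_split.
by apply: eq_bigr => i _; rewrite coefD scalerDl.
Qed.

Lemma skew_act0 y : skew_act 0 y = 0.
Proof. by rewrite /skew_act size_poly0 big_ord0. Qed.

Lemma skew_actv0 P : skew_act P 0 = 0.
Proof.
rewrite /skew_act big1 // => i _; rewrite (_ : iter i phi 0 = 0) ?scaler0 //.
by elim: (nat_of_ord i) => //= n ->; rewrite linear0.
Qed.

Lemma skew_actN P y : skew_act (- P) y = - skew_act P y.
Proof. by apply/eqP; rewrite -addr_eq0 -skew_actD addNr skew_act0. Qed.

Lemma skew_actB P Q y : skew_act (P - Q) y = skew_act P y - skew_act Q y.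
Proof. by rewrite skew_actD skew_actN. Qed.

Lemma skew_act_skewCM c P y :
  skew_act (skewC sigma c * P) y = c *: skew_act P y.
Proof.
rewrite skew_mulCl (skew_actE y (size_scale_leq c P)) scaler_sumr.
by apply: eq_bigr => i _; rewrite coefZ scalerA.
Qed.

Lemma skew_act_skewXM P y : skew_act (skewX sigma * P) y = phi (skew_act P y).
Proof.
have le_s : (size (skewX sigma * P)%R <= (size P).+1)%N.
  by apply/leq_sizeP => -[|i] lt_i; rewrite coef_skew_mulXl // nth_default ?rmorph0.
rewrite (skew_actE y le_s) big_ord_recl coef_skew_mulXl scale0r add0r.
by rewrite linear_sum; apply: eq_bigr => i _; rewrite coef_skew_mulXl linearZ.
Qed.

Lemma skew_act1 y : skew_act 1 y = y.
Proof. by rewrite /skew_act size_poly1 big_ord1 coef1 scale1r. Qed.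

Lemma skew_act_skewC c y : skew_act (skewC sigma c) y = c *: y.
Proof. by rewrite -[skewC sigma c]mulr1 skew_act_skewCM skew_act1. Qed.

Lemma skew_act_skewX y : skew_act (skewX sigma) y = phi y.
Proof. by rewrite -[skewX sigma]mulr1 skew_act_skewXM skew_act1. Qed.

(** Induction on P with Q and y general: (P X + c) Q = P (X Q) + c Q, so the hypothesis is used at X
    Q. Semilinearity of [phi] enters through the action of X Q. *)
Lemma skew_actM P Q y : skew_act (P * Q) y = skew_act P (skew_act Q y).
Proof.
elim/skew_poly_ind: P Q y => [Q y|P c IH Q y]; first by rewrite mul0r !skew_act0.
rewrite mulrDl -mulrA !skew_actD !IH skew_act_skewXM skew_act_skewCM.
by rewrite skew_act_skewX skew_act_skewC.
Qed.

Lemma skew_act_skewXn n y : skew_act (skewX sigma ^+ n) y = iter n phi y.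
Proof.
by elim: n => [|n IH]; rewrite ?skew_act1 // exprS skew_act_skewXM IH.
Qed.

Lemma skew_act_sum (I : Type) (r : seq I) (F : I -> S) y :
  skew_act (\sum_(i <- r) F i) y = \sum_(i <- r) skew_act (F i) y.
Proof.
apply: (big_morph (skew_act^~ y)) => [P Q|]; last exact: skew_act0.
exact: skew_actD.
Qed.

Lemma phi_orbitE z :
  phi_orbit phi z = mkseq (fun i => iter i phi z) (\dim {:D}) :> seq D.
Proof. by rewrite /mkseq -val_enum_ord -map_comp. Qed.

(** The first dim D + 1 iterates cannot be free, so some iterate depends on its predecessors. *)
Lemma exists_iter_mem_span z : exists2 m, (m <= \dim {:D})%N &
  iter m phi z \in <<mkseq (fun i => iter i phi z) m>>%VS.
Proof.
have dimW n : (exists2 m, (m < n)%N &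
    iter m phi z \in <<mkseq (fun i => iter i phi z) m>>%VS) \/
    free (mkseq (fun i => iter i phi z) n).
  elim: n => [|n [[m lt_mn mz]|fr]]; first by right; apply: nil_free.
    by left; exists m => //; apply: ltnW.
  have [zn|zn] := boolP (iter n phi z \in <<mkseq (fun i => iter i phi z) n>>%VS).
    by left; exists n.
  right; rewrite /mkseq -addn1 iotaD map_cat /= cats1.
  set s := map _ _; have /permPl eq_s := perm_rcons (iter n phi z) s.
  by rewrite (perm_free eq_s) free_cons zn.
case: (dimW (\dim {:D}).+1) => [[m lt_mn mz]|/eqP fr]; first by exists m.
by have := dimvS (subvf <<mkseq (fun i => iter i phi z) (\dim {:D}).+1>>%VS);
   rewrite fr size_mkseq ltnn.
Qed.

Lemma span_phi_closed (s : seq D) (U : {vspace D}) :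
  {in s, forall y, phi y \in U} -> {in <<s>>%VS, forall y, phi y \in U}.
Proof.
move=> sU y /(coord_span (X := in_tuple s)) ->; rewrite linear_sum.
by apply: memv_suml => i _; rewrite linearZ memvZ // sU // mem_nth.
Qed.

(** Once the m-th iterate depends on the earlier ones, the span of the first m iterates is stable
    under [phi], hence contains every iterate. As m is at most dim D, the orbit spans it. *)
Lemma iter_mem_span_orbit z i : iter i phi z \in <<phi_orbit phi z>>%VS.
Proof.
have [m le_m mz] := exists_iter_mem_span z.
rewrite phi_orbitE.
have stW : phi_stable phi <<mkseq (fun i => iter i phi z) m>>%VS.
  apply: span_phi_closed => y /mapP[j]; rewrite mem_iota => /andP[_ lt_jm] ->.
  rewrite add0n in lt_jm; rewrite -iterS; have [->//|neq] := eqVneq j.+1 m.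
  by apply/memv_span/map_f; rewrite mem_iota /= add0n ltn_neqAle neq.
have sub : (<<mkseq (fun i => iter i phi z) m>>
    <= <<mkseq (fun i => iter i phi z) (\dim {:D})>>)%VS.
  apply: sub_span => y /mapP[j]; rewrite mem_iota => /andP[_ lt_jm] ->.
  by apply: map_f; rewrite mem_iota /= (leq_trans lt_jm).
apply: (subvP sub); elim: i => [|i IH]; last exact: stW.
(* For m = 0 the hypothesis [mz] is already the goal; otherwise z heads the list. *)
case: m mz {le_m stW sub} => // m _.
exact/memv_span/mem_head.
Qed.

Lemma skew_act_mem_span_orbit P z : skew_act P z \in <<phi_orbit phi z>>%VS.
Proof. by apply: memv_suml => i _; apply/memvZ/iter_mem_span_orbit. Qed.

Lemma span_orbit_skew_act z y :
  y \in <<phi_orbit phi z>>%VS -> exists P, y = skew_act P z.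
Proof.
move/coord_span=> {1}->.
exists (\sum_(i < \dim {:D})
  skewC sigma (coord (phi_orbit phi z) i y) * skewX sigma ^+ i).
rewrite skew_act_sum; apply: eq_bigr => i _.
by rewrite skew_act_skewCM skew_act_skewXn -tnth_nth tnth_mktuple.
Qed.

Lemma span_orbit_stable z : phi_stable phi <<phi_orbit phi z>>%VS.
Proof.
move=> _ /span_orbit_skew_act[P ->].
by rewrite -skew_act_skewXM skew_act_mem_span_orbit.
Qed.

(** Being a generator amounts to cyclicity, a form that passes to quotients at once. For the
    converse, dim D vectors that span D form a basis. *)
Lemma generatorP x : generator phi x <-> forall y, exists P, y = skew_act P x.
Proof.
split=> [gx y|gx].
  by apply: span_orbit_skew_act; rewrite (span_basis gx) memvf.
rewrite /generator basisEdim size_tuple leqnn andbT; apply/subvP => y _.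
by have [P ->] := gx y; apply: skew_act_mem_span_orbit.
Qed.

(** * The annihilator of a generator *)

Section Generator.
Variables (x : D) (gx : generator phi x).
Local Notation chi := (semichar phi x).

Let semichar_low : S :=
  \sum_(i < \dim {:D}) skewC sigma (semichar_coef phi x i) * skewX sigma ^+ i.

Let size_semichar_low : (size semichar_low < size ('X^(\dim {:D}) : {poly K}))%N.
Proof.
rewrite size_polyXn ltnS; apply: leq_trans (size_sum _ _ _) _.
apply/bigmax_leqP => i _; rewrite skew_mulCl skewXnE.
by apply: leq_trans (size_scale_leq _ _) _; rewrite size_polyXn.
Qed.

Let semicharE : chi = 'X^(\dim {:D}) - (semichar_low : {poly K}).
Proof. by rewrite /semichar skewXnE. Qed.

Lemma size_semichar : size chi = (\dim {:D}).+1.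
Proof. by rewrite semicharE size_polyDl ?size_polyN // size_polyXn. Qed.

Lemma semichar_monic : chi \is monic.
Proof.
by rewrite monicE semicharE lead_coefDl ?size_polyN // lead_coefXn.
Qed.

Lemma skew_act_semichar : skew_act chi x = 0.
Proof.
rewrite skew_actB skew_act_sum skew_act_skewXn (semichar_coefE gx).
apply/eqP; rewrite subr_eq0; apply/eqP; apply: eq_bigr => i _.
by rewrite skew_act_skewCM skew_act_skewXn.
Qed.

(** The remainder R of P modulo chi has degree below dim D and kills x. Thus R . x = 0 is a linear
    relation on the free orbit of x, and R = 0. *)
Lemma skew_act_eq0P P : skew_act P x = 0 <-> right_divides chi P.
Proof.
split=> [Px0|[Q ->]]; last by rewrite skew_actM skew_act_semichar skew_actv0.
have [Q [R [PE ltR]]] := skew_right_division P semichar_monic.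
exists Q; have Rx0 : skew_act R x = 0.
  have := Px0; rewrite PE skew_actD skew_actM skew_act_semichar skew_actv0.
  by rewrite add0r.
suff R0 : R = 0 by rewrite PE R0 addr0.
rewrite size_semichar ltnS in ltR.
have /freeP fr := basis_free gx.
have coefR0 i : (i < \dim {:D})%N -> R`_i = 0.
  move=> lt_i; apply: (fr (fun j => R`_j) _ (Ordinal lt_i)).
  rewrite -[RHS]Rx0 (skew_actE x ltR); apply: eq_bigr => j _.
  by rewrite -tnth_nth tnth_mktuple.
apply/polyP => i; rewrite coef0.
have [/coefR0//|le_i] := ltnP i (\dim {:D}).
by rewrite nth_default // (leq_trans ltR).
Qed.
End Generator.
End SkewAction.

(** * Stable subspaces and monic right divisors *)

Section Correspondence.
Variables (K : fieldType) (sigma : {rmorphism K -> K}) (D : vectType K).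
Variable phi : {linear D -> D | sigma \; *:%R}.
Variables (x : D) (gx : generator phi x).
Local Notation S := (skew_poly sigma).
Local Notation chi := (semichar phi x).
Local Notation chiq U := (semichar (quot_phi U) (quotv_proj U x)).
Implicit Types (U V : phi_subspace phi) (A P : S).

Lemma skew_act_quot U P y :
  skew_act (quot_phi U) P (quotv_proj U y) = quotv_proj U (skew_act phi P y).
Proof.
rewrite /skew_act linear_sum; apply: eq_bigr => i _; rewrite linearZ /=.
by congr (_ *: _); elim: (nat_of_ord i) => //= n ->; rewrite quot_phiE.
Qed.

Lemma generator_quot U : generator (quot_phi U) (quotv_proj U x).
Proof.
apply/generatorP => v; have [P vE] := (generatorP phi x).1 gx (repr v).
by exists P; rewrite skew_act_quot -vE quotv_projK.
Qed.

(** P . x lies in U exactly when P kills the image of x in D / U, which is a generator with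
    semi-characteristic polynomial [chiq U]. *)
Lemma mem_skew_actP U P :
  skew_act phi P x \in (U : {vspace D}) <-> right_divides (chiq U) P.
Proof.
rewrite -(skew_act_eq0P (generator_quot U)) skew_act_quot.
rewrite -[_ \in _]/(_ \in phi_subspace_val U).
rewrite -[X in X \in _]subr0 -eq_quotv_proj linear0.
by split=> /eqP.
Qed.

Lemma semichar_quot_divides U : right_divides (chiq U) chi.
Proof. by apply/mem_skew_actP; rewrite skew_act_semichar ?mem0v. Qed.

(** Every vector is some P . x, so membership in U is decided by divisibility by [chiq U] alone. *)
Lemma semichar_quot_inj U V :
  chiq U = chiq V -> phi_subspace_val U = phi_subspace_val V.
Proof.
move=> eqUV; apply/vspaceP => y; have [P ->] := (generatorP phi x).1 gx y.
by apply/idP/idP => /mem_skew_actP yU; apply/mem_skew_actP; move: yU; rewrite eqUV.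
Qed.

Lemma semichar_quot_surj A :
  A \is monic -> right_divides A chi -> exists U, chiq U = A.
Proof.
move=> monA [B chiBA].
pose z := skew_act phi A x.
pose U := PhiSubspace (@span_orbit_stable _ _ _ phi z).
have monU := semichar_monic (quot_phi U) (quotv_proj U x).
exists U; apply: right_divides_monic_eq => //.
  by apply/mem_skew_actP; rewrite -[skew_act _ A x]/z -[z](skew_act1 phi)
     skew_act_mem_span_orbit.
(* As [chiq U] divides itself, its action on x lies in U, hence equals Q . z = (Q A) . x. Then
   [chiq U] - Q A kills x, so it is C chi = C B A, and A right-divides [chiq U]. *)
have /mem_skew_actP/span_orbit_skew_act[Q] : right_divides (chiq U) (chiq U).
  by exists 1; rewrite mul1r.
move/eqP; rewrite -skew_actM -subr_eq0 -skew_actB => /eqP.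
case/(skew_act_eq0P gx) => C /eqP; rewrite chiBA subr_eq mulrA -mulrDl => /eqP->.
by exists (C * B + Q).
Qed.
End Correspondence.

(** * Irreducibility of the semi-characteristic polynomial and simplicity of the module *)

Section Simple.
Variables (K : fieldType) (sigma : {rmorphism K -> K}) (D : vectType K).
Variable phi : {linear D -> D | sigma \; *:%R}.
Variables (x : D) (gx : generator phi x).
Local Notation S := (skew_poly sigma).
Local Notation chi := (semichar phi x).

Lemma right_divides_unit (A P : S) : two_sided_unit A -> right_divides A P.
Proof. by case=> V [_ VA]; exists (P * V); rewrite -mulrA VA mulr1. Qed.

Lemma two_sided_unitMr (A B : S) :
  two_sided_unit A -> right_divides B A -> two_sided_unit B.
Proof.
case=> V [_ VA] [U AUB].
by apply: (@skew_unit_of_left_inverse _ _ _ (V * U)); rewrite -mulrA -AUB.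
Qed.

(** A stable U gives a factorization chi = B * chi_U. If B is a unit, multiples of chi_U are
    multiples of chi and U = 0; if chi_U is a unit, it divides everything and U = D. *)
Lemma irreducible_simple : irreducible_elt chi -> simple_phi phi.
Proof.
case=> chi0 nunit irr; split.
  exists x; apply/eqP => x0; apply: nunit.
  (* If x = 0 then 1 annihilates x, so chi divides 1 and is a unit. *)
  have : right_divides chi 1 by apply/(skew_act_eq0P gx); rewrite skew_act1.
  apply: two_sided_unitMr; exists 1; by rewrite mulr1.
move=> U stU; pose U' := PhiSubspace stU.
have [B chiB] := semichar_quot_divides gx U'.
case: (irr _ _ chiB) => [[V [_ VB]]|unitU]; [left|right]; apply/vspaceP => y;
  have [P ->] := (generatorP phi x).1 gx y.
  rewrite memv0; apply/idP/eqP => [|->]; last exact: mem0v.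
  case/(mem_skew_actP gx U') => Q ->; apply/(skew_act_eq0P gx).
  by exists (Q * V); rewrite chiB -!mulrA (mulrA V) VB mul1r.
rewrite memvf; apply/(mem_skew_actP gx U'); exact: right_divides_unit.
Qed.

(** For chi = B C, the monic multiple A of C is chi_U for some stable U. Simplicity leaves U = 0,
    which makes B a unit, or U = D, which makes C a unit. *)
Lemma simple_irreducible : simple_phi phi -> irreducible_elt chi.
Proof.
case=> -[y y0] simp.
have chi0 : chi != 0 by apply/monic_neq0/semichar_monic.
have nunit : ~ two_sided_unit chi.
  move=> uchi; case/eqP: y0; have [P ->] := (generatorP phi x).1 gx y.
  by apply/(skew_act_eq0P gx)/right_divides_unit.
split=> // B C chiBC.
have C0 : C != 0 by apply: contraNneq chi0 => C0; rewrite chiBC C0 mulr0.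
have lC0 : lead_coef C != 0 by rewrite lead_coef_eq0.
pose A : S := skewC sigma (lead_coef C)^-1 * C.
have CA : C = skewC sigma (lead_coef C) * A.
  by rewrite /A !skew_mulCl scalerA divff // scale1r.
have monA : A \is monic by rewrite /A skew_mulCl monicE lead_coefZ mulVf.
have [U chiU] : exists U : phi_subspace phi,
    semichar (quot_phi U) (quotv_proj U x) = A.
  apply: semichar_quot_surj => //.
  by exists (B * skewC sigma (lead_coef C)); rewrite -mulrA -CA.
have [U0|UT] := simp _ (phi_subspaceP (p := U)); [left|right].
  have : right_divides chi A.
    apply/(skew_act_eq0P gx)/eqP; rewrite -memv0 -U0.
    by apply/(mem_skew_actP gx U); rewrite chiU; exists 1; rewrite mul1r.
  case=> Q AQ.
  (* With c the leading coefficient of C, C = c A = c Q chi = (c Q B) C; cancelling C gives (c Q) B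
     = 1. *)
  apply: (@skew_unit_of_left_inverse _ _ _ (skewC sigma (lead_coef C) * Q)).
  by apply: (skew_mulIr C0); rewrite /= mul1r {3}CA AQ chiBC !mulrA.
have [Q Q1] : right_divides A 1.
  by rewrite -chiU; apply/(mem_skew_actP gx U); rewrite UT memvf.
apply: (@skew_unit_of_left_inverse _ _ _ (Q * skewC sigma (lead_coef C)^-1)).
by rewrite -mulrA -Q1.
Qed.

End Simple.

Theorem proposition1p4p5
  (K : fieldType) (p a : nat) (charK : p \in [pchar K]) (a_gt0 : (0 < a)%N)
  (Fq : finFieldType) (cardFq : #|Fq| = (p ^ a)%N) (iota : {rmorphism Fq -> K})
  (D : vectType K) (phi : {linear D -> D | frobq charK a \; *:%R})
  (phi_etale : etale phi) (x : D) (x_gen : generator phi x) :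
  let chi : skew_poly (frobq charK a) := semichar phi x in
  let chi_quot (U : phi_subspace phi) : skew_poly (frobq charK a) :=
    semichar (quot_phi U) (quotv_proj U x) in
  [/\ forall U, chi_quot U \is monic /\ right_divides (chi_quot U) chi,
      forall U V, chi_quot U = chi_quot V ->
        phi_subspace_val U = phi_subspace_val V,
      forall A : skew_poly (frobq charK a),
        A \is monic -> right_divides A chi -> exists U, chi_quot U = A
    & forall U, irreducible_elt (chi_quot U) <-> simple_phi (quot_phi U)].
Proof.
move=> chi chi_quot; split=> [U|||U].
- by split; [apply: semichar_monic | apply: semichar_quot_divides].
- exact: semichar_quot_inj.
- exact: semichar_quot_surj.
(* Both implications are applied to the module D / U, generated by the image of x. *)
- split; first exact/irreducible_simple/generator_quot.
  exact/simple_irreducible/generator_quot.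
Qed.
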